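(* Let $X=\ell^p(\mathbb{Z})$ with $1\leq p<\infty$, or $X=c_0(\mathbb{Z})$, and let $w=\{w_j\}_{j\in\mathbb{Z}}$ be a bounded sequence of non-zero scalars. Let $B_w\colon X\to X$ be the bilateral backward weighted shift, $B_we_i=w_ie_{i-1}$ for all $i\in\mathbb{Z}$ (i.e. $(B_wx)_{i}=w_{i+1}x_{i+1}$), where $\{e_i\}_{i\in\mathbb{Z}}$ is the canonical basis. Then the following are equivalent: (1) $\liminf_{n\to\infty}\prod_{j=-n+1}^{0}|w_j|=0$ and $\sup_{k\in\mathbb{Z},n\in\mathbb{N}}\prod_{j=k}^{k+n}|w_j|=\infty$; (2) there exists a Li-Yorke scrambled pair for $B_w$; (3) $B_w$ is Li-Yorke chaotic; (4) $B_w$ admits a dense irregular manifold; (5) $B_w$ is densely uniformly Li-Yorke chaotic.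
   Context: A pair $(x,y)\in X\times X$ is Li-Yorke scrambled for $T$ if $\liminf_n\|T^nx-T^ny\|=0$ and $\limsup_n\|T^nx-T^ny\|>0$; $T$ is Li-Yorke chaotic if there is an uncountable set $S\subset X$ every pair of distinct points of which is Li-Yorke scrambled. A vector $x$ is irregular if $\liminf_n\|T^nx\|=0$ and $\limsup_n\|T^nx\|=\infty$; an irregular manifold is a vector subspace all of whose non-zero vectors are irregular. A subset $S\subset X$ with at least two points is uniformly Li-Yorke scrambled for $T$ if there exist sequences $\{p_n\}$, $\{q_n\}$ in $\mathbb{N}$ such that for all distinct $x,y\in S$: $\lim_n\|T^{p_n}x-T^{p_n}y\|=0$ and $\lim_n\|T^{q_n}x-T^{q_n}y\|=\infty$; $T$ is densely uniformly Li-Yorke chaotic if there is a dense, uncountable such set. *)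

(* Defs.v *)
From HB Require Import structures.
From mathcomp Require Import all_boot all_order all_algebra.
From mathcomp Require Import all_classical all_reals all_analysis.
From mathcomp Require Import complex.
Set Implicit Arguments. Unset Strict Implicit. Unset Printing Implicit Defensive.
Import Order.TTheory GRing.Theory Num.Theory numFieldNormedType.Exports.
Local Open Scope classical_set_scope.
Local Open Scope ring_scope.

Inductive seqspace (R : realType) :=
| Lp of R
| C0.

Definition valid_space (R : realType) (sp : seqspace R) : Prop :=
  match sp with Lp p => 1 <= p | C0 => True end.

Section SeqSpaces.
Variables (R : realType) (K : nzRingType).
(* [nabs] is the modulus of scalars (|.| on R, complex modulus on C). *)
Variable nabs : K -> R.

Definition inX (sp : seqspace R) (x : int -> K) : Prop :=
  match sp with
  | Lp p => (\esum_(i in [set: int]) ((nabs (x i)) `^ p)%:E < +oo)%E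
  | C0 => forall eps : R, 0 < eps ->
            exists N : nat, forall i : int, (N < `|i|)%N -> nabs (x i) < eps
  end.

Definition nrm (sp : seqspace R) (x : int -> K) : R :=
  match sp with
  | Lp p => (fine (\esum_(i in [set: int]) ((nabs (x i)) `^ p)%:E)) `^ p^-1
  | C0 => sup (range (fun i => nabs (x i)))
  end.

Definition Xset (sp : seqspace R) : set (int -> K) := [set x | inX sp x].

Definition dense_in_X (sp : seqspace R) (S : set (int -> K)) : Prop :=
  forall x, inX sp x -> forall eps : R, 0 < eps ->
    exists2 s, S s & nrm sp (x \- s) < eps.

Definition Bw (w : int -> K) (x : int -> K) : int -> K :=
  fun i => w (i + 1) * x (i + 1).

Definition orbit_dist (sp : seqspace R) (T : (int -> K) -> int -> K)
  (x y : int -> K) : (\bar R)^nat :=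
  fun n => (nrm sp (iter n T x \- iter n T y))%:E.

Definition LY_scrambled_pair sp T (x y : int -> K) : Prop :=
  inX sp x /\ inX sp y /\
  limn_einf (orbit_dist sp T x y) = 0%E /\ (0 < limn_esup (orbit_dist sp T x y))%E.

Definition LY_chaotic sp T : Prop :=
  exists S : set (int -> K), S `<=` Xset sp /\ ~ countable S /\
    forall x y, S x -> S y -> x <> y -> LY_scrambled_pair sp T x y.

Definition irregular sp T (x : int -> K) : Prop :=
  limn_einf (fun n => (nrm sp (iter n T x))%:E) = 0%E /\
  limn_esup (fun n => (nrm sp (iter n T x))%:E) = +oo%E.

Definition vector_subspace sp (M : set (int -> K)) : Prop :=
  M `<=` Xset sp /\ M (fun _ => 0) /\
  forall (a : K) x y, M x -> M y -> M (fun i => a * x i + y i).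

Definition irregular_manifold sp T (M : set (int -> K)) : Prop :=
  vector_subspace sp M /\ forall x, M x -> x <> (fun _ => 0) -> irregular sp T x.

Definition uniformly_LY_scrambled sp T (S : set (int -> K)) : Prop :=
  S `<=` Xset sp /\ (exists x y, S x /\ S y /\ x <> y) /\
  exists p q : nat -> nat, forall x y, S x -> S y -> x <> y ->
    (fun n => nrm sp (iter (p n) T x \- iter (p n) T y)) @ \oo --> (0 : R) /\
    (fun n => nrm sp (iter (q n) T x \- iter (q n) T y)) @ \oo --> +oo.

Definition densely_uniformly_LY_chaotic sp T : Prop :=
  exists S : set (int -> K), dense_in_X sp S /\ ~ countable S /\
    uniformly_LY_scrambled sp T S.

Definition weighted_shift_TFAE (sp : seqspace R) (w : int -> K) : Prop :=
  [<-> (limn_einf (fun n : nat => (\prod_(0 <= j < n) nabs (w (- j%:Z)))%:E) = 0%E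
        /\ ereal_sup (range (fun kn : int * nat =>
             (\prod_(0 <= i < kn.2.+1) nabs (w (kn.1 + i%:Z)))%:E)) = +oo%E);
       exists x y, LY_scrambled_pair sp (Bw w) x y;
       LY_chaotic sp (Bw w);
       exists M, irregular_manifold sp (Bw w) M /\ dense_in_X sp M;
       densely_uniformly_LY_chaotic sp (Bw w)].

End SeqSpaces.

Definition cmod (R : realType) (z : complex.complex R) : R :=
  Num.sqrt (complex.Re z ^+ 2 + complex.Im z ^+ 2).

(* Main.v *)
(* Let T be the shift.  The norms of the T^n are products over blocks of consecutive
   weights, and T^n e_i carries the product over the block of length n ending at i.
   A nonzero z with liminf |T^n z| = 0 and not T^n z -> 0 forces the block products
   ending at 0 to have infimum 0 (look at one nonzero coordinate of z) and all block
   products to be unbounded (otherwise the powers of T are uniformly bounded and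
   T^n z -> 0).  Each of the chaos conditions yields such a z.

   Conversely, small block products ending at 0 give times p_N at which T^(p_N) is
   small on all e_i with |i| <= N, and unboundedness gives arbitrarily distant e_i
   with T^m e_i arbitrarily large.  Choose such sites i_k and times q_k inductively,
   with coefficients c_k so small that c_k e_(i_k) is not seen at the earlier times p,
   but with c_k T^(q_k) e_(i_k) huge.  The vectors e_(d_j) + sum_k c_k s_k^j e_(i_k),
   with s_k = 2^-(k+1) and d_j running through each integer infinitely often, span a
   dense subspace.  Every nonzero vector of it has the coordinate c_k P(s_k) at i_k for
   large k, with P a nonzero polynomial, so it tends to 0 along p and to infinity along
   q.  This one subspace witnesses all the chaos conditions. *)
Require Import Defs.
From HB Require Import structures.
From mathcomp Require Import all_boot all_order all_algebra.
From mathcomp Require Import all_classical all_reals all_analysis.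
From mathcomp Require Import complex.
From mathcomp Require Import zify ring lra.
Set Implicit Arguments. Unset Strict Implicit. Unset Printing Implicit Defensive.
Import Order.TTheory GRing.Theory Num.Theory numFieldNormedType.Exports.
Local Open Scope classical_set_scope.
Local Open Scope ring_scope.

(** * Norm estimates for nonnegative real sequences in l^p and c_0 *)

Section NonnegativeSequences.
Variable R : realType.
Implicit Types (f g h : int -> R) (sp : seqspace R) (p A : R).

(** With the identity as modulus these apply to the sequence of moduli of a vector, so that real and
    complex scalars share one set of norm estimates. *)
Definition mod_inX sp f := inX (fun t : R => t) sp f.
Definition mod_nrm sp f := nrm (fun t : R => t) sp f.
Arguments mod_inX : simpl never.
Arguments mod_nrm : simpl never.
Definition psum p f : \bar R := \esum_(i in [set: int]) ((f i) `^ p)%:E.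

Lemma psum_ge0 p f : (0 <= psum p f)%E.
Proof. by apply: esum_ge0 => i _; rewrite lee_fin powR_ge0. Qed.

Lemma mod_nrmLp_le p f A : 0 < p -> 0 <= A ->
  (psum p f <= (A `^ p)%:E)%E -> mod_inX (Lp p) f /\ mod_nrm (Lp p) f <= A.
Proof.
move=> p0 A0 le; have fin : (psum p f < +oo)%E by apply: le_lt_trans le _; rewrite ltry.
split; first exact: fin.
rewrite /mod_nrm /nrm -/(psum p f).
have -> : A = (A `^ p) `^ p^-1 by rewrite -powRrM divff ?powRr1 // gt_eqF.
have [r r0 E] : exists2 r : R, 0 <= r & psum p f = r%:E.
  move: (psum_ge0 p f) fin; case: (psum p f) => [r| |] //; exists r => //.
rewrite E /= in le *; apply: ge0_ler_powR; rewrite ?nnegrE ?invr_ge0 ?powR_ge0 ?(ltW p0) //.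
Qed.

Lemma psum_nrm p f : 0 < p -> mod_inX (Lp p) f ->
  psum p f = (mod_nrm (Lp p) f `^ p)%:E.
Proof.
move=> p0; rewrite /mod_inX /mod_nrm /= -/(psum p f) => fin.
move: (psum_ge0 p f) fin; case: (psum p f) => [r| |] //= r0 _.
by rewrite -powRrM mulVf ?gt_eqF // powRr1.
Qed.

Lemma le_psum p f g : 0 <= p -> (forall i, 0 <= f i <= g i) ->
  (psum p f <= psum p g)%E.
Proof.
move=> p0 fg; apply: le_esum => i _; rewrite lee_fin.
by have /andP[f0 le] := fg i; apply: ge0_ler_powR; rewrite ?nnegrE // (le_trans f0).
Qed.

Lemma psum_shift p f c : psum p (fun i => f (i + c)) = psum p f.
Proof.
rewrite /psum [RHS](reindex_esum [set: int] [set: int] (fun i => i + c)) //; split => //.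
  by move=> i j _ _ /addIr.
by move=> i _; exists (i - c) => //; rewrite subrK.
Qed.

Lemma powR_half n p : 1 <= p -> ((2^-1 : R) ^+ n) `^ p <= 2^-1 ^+ n.
Proof.
move=> p1; apply: ge1r_powR => //.
by rewrite exprn_gt0 ?invr_gt0 //= exprn_ile1 // ?invr_ge0 // invf_le1 // ler1n.
Qed.

Lemma psumZ p f A : 0 <= A -> (forall i, 0 <= f i) ->
  psum p (fun i => A * f i) = ((A `^ p)%:E * psum p f)%E.
Proof.
move=> A0 f0; rewrite /psum.
under eq_esum do rewrite powRM // EFinM.
rewrite {1}/esum; set S := [set _ | _ in _].
have -> : S = [set ((A `^ p)%:E * x)%E | x in
    [set (\sum_(i \in F) ((f i `^ p)%:E))%E | F in fsets [set: int]]].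
  rewrite /S; apply/seteqP; split => x /=.
    move=> [F FT <-]; exists (\sum_(i \in F) ((f i `^ p)%:E))%E; first by exists F.
    rewrite !fsbig_finite; try by case: FT.
    by rewrite -ge0_sume_distrr // => i _; rewrite lee_fin powR_ge0.
  move=> [y [F FT <-] <-]; exists F => //.
  rewrite !fsbig_finite; try by case: FT.
  by rewrite -ge0_sume_distrr // => i _; rewrite lee_fin powR_ge0.
rewrite ereal_supZl ?powR_ge0 //.
by apply/set0P; exists 0%E; exists set0; [exact: fsets_set0 | rewrite fsbig_set0].
Qed.

Lemma C0_bounded f : mod_inX (@C0 R) f -> exists B, forall i, f i <= B.
Proof.
move=> h; have [N hN] := h 1 ltr01.
exists (1 + \sum_(k < N.+1) (`|f k%:Z| + `|f (- k%:Z)|)) => i.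
have S0 (k : 'I_N.+1) (_ : k \in predT): 0 <= `|f k%:Z| + `|f (- k%:Z)| by rewrite addr_ge0.
have [/hN /ltW le|iN] := ltnP N `|i|%N.
  by apply: le_trans le _; rewrite lerDl sumr_ge0.
rewrite -ltnS in iN.
rewrite (bigD1 (Ordinal iN)) //=; set s := \sum_(_ < _ | _) _.
have s0 : 0 <= s by apply: sumr_ge0 => k _; rewrite addr_ge0.
have : f i <= `|f (`|i|%N)%:Z| + `|f (- (`|i|%N)%:Z)|.
  have [i0|i0] := leP 0 i.
    by rewrite gez0_abs // (le_trans (ler_norm _)) // lerDl.
  by rewrite ltz0_abs // opprK (le_trans (ler_norm _)) // lerDr.
lra.
Qed.

Lemma C0_le_nrm f i : mod_inX (@C0 R) f -> f i <= mod_nrm (@C0 R) f.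
Proof.
move=> /C0_bounded [B hB]; apply: ub_le_sup; last by exists i.
by exists B => _ [j _ <-].
Qed.

Lemma C0_nrm_le f B : (forall i, f i <= B) -> mod_nrm (@C0 R) f <= B.
Proof. by move=> h; apply: ge_sup; [exists (f 0), 0|move=> _ [i _ <-]]. Qed.

Lemma mod_nrm_ge0 sp f : (forall i, 0 <= f i) -> 0 <= mod_nrm sp f.
Proof.
case: sp => [p|] f0; first exact: powR_ge0.
(* An unbounded range is harmless: [sup] then takes its default value 0. *)
rewrite /mod_nrm /=; have [hs|/sup_out -> //] := pselect (has_sup (range f)).
by apply: le_trans (f0 0) (ub_le_sup (proj2 hs) _); exists 0.
Qed.

Lemma le_mod_nrm sp f i : valid_space sp -> (forall i, 0 <= f i) ->
  mod_inX sp f -> f i <= mod_nrm sp f.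
Proof.
case: sp => [p|] /= p1 f0 fX; last exact: C0_le_nrm.
have p0 : 0 < p by lra.
have : ((f i `^ p)%:E <= psum p f)%E.
  apply: esum_ge; exists [set i]; first by split => //; exact: finite_set1.
  by rewrite fsbig_set1.
rewrite psum_nrm // lee_fin => le.
have F0 : 0 <= mod_nrm (Lp p) f by exact: (mod_nrm_ge0 (Lp p) f0).
have -> : f i = (f i `^ p) `^ p^-1 by rewrite -powRrM divff ?powRr1 // gt_eqF.
have -> : mod_nrm (Lp p) f = (mod_nrm (Lp p) f `^ p) `^ p^-1.
  by rewrite -powRrM divff ?powRr1 // gt_eqF.
by apply: ge0_ler_powR; rewrite ?nnegrE ?powR_ge0 ?invr_ge0 ?(ltW p0).
Qed.

(** One domination principle for scalar multiples, truncations and, through the translation [c],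
    powers of the shift. *)
Lemma mod_nrm_dom sp f g A (c : int) : valid_space sp -> 0 <= A ->
  (forall i, 0 <= f i) -> (forall i, 0 <= g i <= A * f (i + c)) ->
  mod_inX sp f -> mod_inX sp g /\ mod_nrm sp g <= A * mod_nrm sp f.
Proof.
case: sp => [p|] /= p1 A0 f0 gf fX.
  have p0 : 0 < p by lra.
  apply: mod_nrmLp_le => //.
    by rewrite mulr_ge0 //; exact: (mod_nrm_ge0 (Lp p)).
  rewrite powRM //; last exact: (mod_nrm_ge0 (Lp p)).
  rewrite EFinM -psum_nrm // -psumZ // -(psum_shift p (fun i => A * f i) c).
  exact: le_psum (ltW p0) gf.
split; last first.
  apply: C0_nrm_le => i; have /andP[_ /le_trans] := gf i; apply.
  by rewrite ler_wpM2l // C0_le_nrm.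
move=> e e0; have [|N hN] := fX (e / (A + 1)); first by rewrite divr_gt0 // ltr_wpDl.
exists (N + `|c|)%N => i Ni; have /andP[_ le] := gf i.
have /hN lt : (N < `|(i + c)%R|)%N by lia.
apply: le_lt_trans le _; have := f0 (i + c).
move: lt; rewrite ltr_pdivlMr ?ltr_wpDl // => lt f1; nra.
Qed.

(** The constant 4 replaces Minkowski's inequality: in l^p, h <= 2 max(f, g) gives h^p <= (2f)^p +
    (2g)^p pointwise, and the factor 2 lost on adding the two sums is at most 2^p. *)
Lemma mod_nrmD sp f g h : valid_space sp ->
  (forall i, 0 <= f i) -> (forall i, 0 <= g i) ->
  (forall i, 0 <= h i <= f i + g i) -> mod_inX sp f -> mod_inX sp g ->
  mod_inX sp h /\ mod_nrm sp h <= 4 * (mod_nrm sp f + mod_nrm sp g).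
Proof.
case: sp => [p|] /= p1 f0 g0 hfg fX gX; last first.
  split=> [e e0|].
    have [|N hN] := fX (e / 2); first by rewrite divr_gt0.
    have [|N' hN'] := gX (e / 2); first by rewrite divr_gt0.
    exists (N + N')%N => i Ni; have /andP[_ le] := hfg i.
    have /hN lt : (N < `|i|)%N by lia.
    have /hN' lt' : (N' < `|i|)%N by lia.
    lra.
  apply: C0_nrm_le => i; have /andP[_ le] := hfg i.
  have := C0_le_nrm i fX; have := C0_le_nrm i gX; have := f0 i; have := g0 i; lra.
have p0 : 0 < p by lra.
have F0 : 0 <= mod_nrm (Lp p) f by exact: (mod_nrm_ge0 (Lp p)).
have G0 : 0 <= mod_nrm (Lp p) g by exact: (mod_nrm_ge0 (Lp p)).
have := psum_nrm p0 fX; have := psum_nrm p0 gX.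
move: F0 G0; move: (mod_nrm _ f) (mod_nrm _ g) => F G F0 G0 EG EF.
have lep (a b : R) : 0 <= a -> a <= b -> a `^ p <= b `^ p.
  by move=> a0 ab; apply: ge0_ler_powR; rewrite ?nnegrE ?(ltW p0) // (le_trans a0).
apply: mod_nrmLp_le p0 _ _; first by rewrite mulr_ge0 // addr_ge0.
have le1 : (psum p h <= psum p (fun i => (2 * f i)%R) + psum p (fun i => (2 * g i)%R))%E.
  rewrite /psum -esumD; try by move=> i _; rewrite lee_fin powR_ge0.
  apply: le_esum => i _; rewrite -EFinD lee_fin; have /andP[h0 le] := hfg i.
  have f0i := f0 i; have g0i := g0 i.
  have [fg|gf] := leP (f i) (g i).
    apply: le_trans (_ : (2 * g i) `^ p <= _); last by rewrite lerDr powR_ge0.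
    by apply: lep => //; lra.
  apply: le_trans (_ : (2 * f i) `^ p <= _); last by rewrite lerDl powR_ge0.
  by apply: lep => //; lra.
apply: le_trans le1 _; rewrite !psumZ // EF EG -!EFinM -EFinD lee_fin.
rewrite -!powRM //.
have le2 : (4 * (F + G)) `^ p >= 2 * (2 * (F + G)) `^ p.
  have -> : 4 * (F + G) = 2 * (2 * (F + G)) by ring.
  rewrite [leRHS]powRM ?mulr_ge0 ?addr_ge0 // ler_wpM2r ?powR_ge0 //.
  by apply: le1r_powR => //; rewrite ler1n.
apply: le_trans le2.
have h1 : (2 * F) `^ p <= (2 * (F + G)) `^ p by apply: lep; lra.
have h2 : (2 * G) `^ p <= (2 * (F + G)) `^ p by apply: lep; lra.
lra.
Qed.

Lemma psum_sparse p (f : int -> R) (t : nat -> int) : 0 < p -> injective t ->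
  (forall i, ~ range t i -> f i = 0) ->
  psum p f = \esum_(k in [set: nat]) ((f (t k)) `^ p)%:E.
Proof.
move=> p0 ti f0; rewrite /psum (@esumID _ _ (range t)); last first.
  by move=> i _; rewrite lee_fin powR_ge0.
rewrite [X in (_ + X)%E]esum1 ?adde0; last first.
  by move=> i [_ /f0 ->]; rewrite powR0 // gt_eqF.
by rewrite setTI esum_image // => i j _ _ /ti.
Qed.

Lemma geometric_half n : \sum_(0 <= k < n) (2^-1 : R) ^+ k <= 2.
Proof.
suff -> : \sum_(0 <= k < n) (2^-1 : R) ^+ k = 2 - 2 * 2^-1 ^+ n.
  by rewrite gerBl mulr_ge0 // exprn_ge0 // invr_ge0.
elim: n => [|n IH]; first by rewrite big_nil expr0 mulr1 subrr.
by rewrite big_nat_recr //= IH exprS; field.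
Qed.

(** In l^p the sum is at most A^p times a geometric sum, since the p-th power of 2^-k is at most
    2^-k, and 2 A^p <= (2A)^p. *)
Lemma mod_nrm_sparse sp f (t : nat -> int) A : valid_space sp -> 0 <= A ->
  injective t -> (forall i, ~ range t i -> f i = 0) ->
  (forall k, 0 <= f (t k) <= A * 2^-1 ^+ k) ->
  mod_inX sp f /\ mod_nrm sp f <= 2 * A.
Proof.
move=> vsp A0 ti fz fb.
have pw k : 0 <= (2^-1 : R) ^+ k <= 1.
  by rewrite exprn_ge0 ?invr_ge0 //= exprn_ile1 // ?invr_ge0 // invf_le1 // ler1n.
case: sp vsp => [p|] /= p1.
  have p0 : 0 < p by lra.
  apply: mod_nrmLp_le => //; first by rewrite mulr_ge0.
  rewrite (psum_sparse p0 ti fz) -nneseries_esumT; last by move=> k; rewrite lee_fin powR_ge0.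
  apply: lime_le; first by apply: is_cvg_nneseries => k _ _; rewrite lee_fin powR_ge0.
  apply: nearW => n; rewrite sumEFin lee_fin.
  apply: le_trans (_ : \sum_(0 <= k < n) A `^ p * 2^-1 ^+ k <= _).
    apply: ler_sum => k _; have /andP[f0 le] := fb k; have /andP[w0 w1] := pw k.
    apply: le_trans (_ : (A * 2^-1 ^+ k) `^ p <= _).
      by apply: ge0_ler_powR; rewrite ?nnegrE ?mulr_ge0 ?(ltW p0).
    by rewrite powRM // ler_wpM2l ?powR_ge0 // powR_half.
  rewrite -mulr_sumr powRM // mulrC ler_wpM2r ?powR_ge0 //.
  by apply: le_trans (geometric_half n) _; apply: le1r_powR => //; rewrite ler1n.
have fb' i : f i <= 2 * A.
  have [[k _ <-]|/fz ->] := pselect (range t i); last by rewrite mulr_ge0.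
  by have /andP[_] := fb k; have /andP[] := pw k; nra.
split; last exact: C0_nrm_le.
move=> e e0.
have [n hn] : exists n, forall k, (n <= k)%N -> A * (2^-1 : R) ^+ k < e.
  have := @cvg_geometric R A 2^-1.
  rewrite ger0_norm ?invr_ge0 // invf_lt1 // ltr1n => /(_ isT).
  move=> /cvgr0Pnorm_lt /(_ _ e0) [n _ hn]; exists n => k nk.
  by apply: le_lt_trans (ler_norm _) (hn k nk).
(* This bounds every |t k| with k < n, so a site beyond it has index at least n. *)
exists (\sum_(k < n) `|t k|)%N => i Ni.
have [[k _ tk]|/fz ->//] := pselect (range t i).
rewrite -tk; have /andP[_ /le_lt_trans] := fb k; apply; apply: hn.
rewrite leqNgt; apply/negP => kn; move: Ni; rewrite -tk (bigD1 (Ordinal kn)) //=.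
by rewrite ltnNge leq_addr.
Qed.

Definition tail (N : nat) f : int -> R := fun i => if (`|i| <= N)%N then 0 else f i.

Lemma finite_int_bounded (F : set int) : finite_set F ->
  exists N : nat, forall i, F i -> (`|i| <= N)%N.
Proof.
move=> /finite_setP[n]; elim: n F => [|n IH] F.
  by rewrite II0 card_eq0 => /eqP ->; exists 0%N.
case/eq_cardSP => x Fx /IH [N hN]; exists (N + `|x|)%N => i Fi.
have [->|/eqP ix] := pselect (i = x); first by rewrite leq_addl.
by apply: leq_trans (leq_addr _ _); apply: hN; split => //; exact/eqP.
Qed.

Lemma mod_nrm_tail sp f (e : R) : valid_space sp -> (forall i, 0 <= f i) ->
  mod_inX sp f -> 0 < e -> exists N : nat, mod_nrm sp (tail N f) <= e.
Proof.
case: sp => [p|] /= p1 f0 fX e0; last first.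
  have [N hN] := fX e e0; exists N; apply: C0_nrm_le => i; rewrite /tail.
  by case: leqP => [_|/hN/ltW //]; exact: ltW.
have p0 : 0 < p by lra.
have ep0 : 0 < e `^ p by rewrite powR_gt0.
have fin : psum p f \is a fin_num by rewrite ge0_fin_numE ?psum_ge0.
(* A finite set whose sum comes within e^p of the total leaves less than e^p outside; [N] is taken
   to cover that set. *)
have := @ub_ereal_sup_adherent _ _ (e `^ p) ep0 fin.
rewrite -/(esum _ _) -/(psum p f) => -[_ [F [finF _] <-]] lt.
have [N hN] := finite_int_bounded finF; exists N.
apply: (proj2 (mod_nrmLp_le _ _ _)) => //; first exact: ltW.
have split_f : psum p f = (\esum_(i in F) (f i `^ p)%:E + \esum_(i in ~` F) (f i `^ p)%:E)%E.
  rewrite /psum (@esumID _ _ F) ?setTI // => i _; by rewrite lee_fin powR_ge0.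
have lt2 : (psum p (tail N f) <= \esum_(i in ~` F) (f i `^ p)%:E)%E.
  rewrite [leRHS]esum_mkcond; apply: le_esum => i _; rewrite /tail.
  case: ifP => [_|iN].
    by rewrite powR0 ?gt_eqF //; case: ifP => // _; rewrite lee_fin powR_ge0.
  rewrite ifT // inE => Fi; by rewrite (hN i Fi) in iN.
apply: le_trans lt2 _.
rewrite -esum_fset in lt => //; last by move=> i _; rewrite lee_fin powR_ge0.
move: lt fin; rewrite split_f.
have : (0 <= \esum_(i in F) (f i `^ p)%:E)%E by apply: esum_ge0 => i _; rewrite lee_fin powR_ge0.
have : (0 <= \esum_(i in ~` F) (f i `^ p)%:E)%E by apply: esum_ge0 => i _; rewrite lee_fin powR_ge0.
case: (\esum_(i in F) _)%E => [a| |] //; case: (\esum_(i in ~` F) _)%E => [b| |] //.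
by rewrite -EFinD -EFinB !lte_fin !lee_fin => _ _ ? _; lra.
Qed.

End NonnegativeSequences.

(** * Lower and upper limits of real sequences *)

Section LimitBounds.
Variable R : realType.
Implicit Types r : nat -> R.

Lemma limn_einf_small r : limn_einf (fun n => (r n)%:E) = 0%E ->
  forall e, 0 < e -> exists n, r n < e.
Proof.
rewrite limn_einf_lim => h e e0.
have : (einfs (fun n => (r n)%:E) 0%N <= 0)%E.
  rewrite -h; have /cvg_lim -> // := @cvg_einfs_sup R (fun n => (r n)%:E).
  by apply: ereal_sup_ubound; exists 0%N.
rewrite /einfs /= => le.
have /ereal_inf_lt [_ [n _ <-]] : (ereal_inf (sdrop (fun n => (r n)%:E) 0%N) < e%:E)%E.
  by apply: le_lt_trans le _; rewrite lte_fin.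
by rewrite lte_fin; exists n.
Qed.

(** Positivity makes small terms recur: a term below both [e] and [r m] cannot be the one at [m], so
    small terms occur arbitrarily late. *)
Lemma limn_einf_eq0 r : (forall n, 0 < r n) ->
  (forall e, 0 < e -> exists n, r n < e) -> limn_einf (fun n => (r n)%:E) = 0%E.
Proof.
move=> r0 small.
have later m : forall e, 0 < e -> exists2 n, (m <= n)%N & r n < e.
  elim: m => [|m IH] e e0; first by have [n] := small e e0; exists n.
  have [|n mn] := IH (Num.min e (r m)); first by rewrite lt_min e0 r0.
  rewrite lt_min => /andP[ne nm]; exists n => //.
  rewrite ltn_neqAle mn andbT; apply/eqP => E; by rewrite E ltxx in nm.
rewrite limn_einf_lim; apply: lim_near_cst => //; apply: nearW => m /=.
apply/eqP; rewrite eq_le; apply/andP; split.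
  apply/lee_addgt0Pr => e e0; rewrite add0e.
  have [n mn lt] := later m e e0.
  apply: le_trans (_ : (r n)%:E <= _)%E; last by rewrite lee_fin ltW.
  by apply: ereal_inf_lbound; exists n.
by apply: le_ereal_inf_tmp => _ [n _ <-]; rewrite lee_fin ltW.
Qed.

Lemma limn_esup_eqy r : (forall A, exists n, A < r n) ->
  limn_esup (fun n => (r n)%:E) = +oo%E.
Proof.
move=> big.
have later m : forall A, exists2 n, (m <= n)%N & A < r n.
  elim: m => [|m IH] A; first by have [n] := big A; exists n.
  have [n mn] := IH (Num.max A (r m)).
  rewrite gt_max => /andP[ne nm]; exists n => //.
  rewrite ltn_neqAle mn andbT; apply/eqP => E; by rewrite E ltxx in nm.
rewrite limn_esup_lim; apply: lim_near_cst => //; apply: nearW => m /=.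
apply/eq_infty => A; have [n mn lt] := later m A.
apply: le_trans (_ : (r n)%:E <= _)%E; first by rewrite lee_fin ltW.
by apply: ereal_sup_ubound; exists n.
Qed.

Lemma limn_esup_le0 r :
  (forall e, 0 < e -> exists m, forall n, (m <= n)%N -> r n <= e) ->
  (limn_esup (fun n => (r n)%:E) <= 0)%E.
Proof.
move=> small; rewrite limn_esup_lim.
have /cvg_lim -> // := @cvg_esups_inf R (fun n => (r n)%:E).
apply/lee_addgt0Pr => e e0; rewrite add0e; have [m hm] := small e e0.
apply: le_trans (_ : esups (fun n => (r n)%:E) m <= _)%E.
  by apply: ereal_inf_lbound; exists m.
by apply: ge_ereal_sup => _ [n mn <-]; rewrite lee_fin hm.
Qed.

End LimitBounds.

(** * Products over blocks of consecutive weights *)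

Section WeightBlocks.
Variables (R : realType) (a : int -> R).

(** The positions are i+1, ..., i+n: for [a] the moduli of the weights, this is the modulus of the
    factor with which the n-th power of the shift moves coordinate i+n to coordinate i. *)
Definition blk (i : int) (n : nat) : R := \prod_(0 <= j < n) a (i + 1 + j%:Z).

Lemma blkD i m n : blk i (m + n) = blk i m * blk (i + m%:Z) n.
Proof.
rewrite /blk (big_cat_nat (n := m)) ?leq_addr //=; congr (_ * _).
rewrite -{1}(addn0 m) addnC big_addn addKn; apply: eq_bigr => j _.
by congr (a _); rewrite PoszD; ring.
Qed.

Lemma blk_back n : \prod_(0 <= j < n) a (- j%:Z) = blk (- n%:Z) n.
Proof.
elim: n => [|n IH]; first by rewrite /blk !big_nil.
rewrite -addn1 addnC blkD {1}/blk big_nat1 add1n big_nat_recr //= IH mulrC.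
by congr (a _ * blk _ _); lia.
Qed.

Lemma blk_forward k n : \prod_(0 <= j < n) a (k + j%:Z) = blk (k - 1) n.
Proof. by apply: eq_bigr => j _; rewrite subrK. Qed.

Variable B : R.
Hypotheses (B1 : 1 <= B) (a_gt0 : forall i, 0 < a i) (a_le : forall i, a i <= B).
Let B_gt0 : 0 < B. Proof. exact: lt_le_trans ltr01 B1. Qed.

Lemma blk_gt0 i n : 0 < blk i n. Proof. by apply: prodr_gt0 => j _. Qed.

Lemma blk_le i n : blk i n <= B ^+ n.
Proof.
rewrite /blk; elim: n => [|n IH]; first by rewrite big_nil.
rewrite big_nat_recr //= exprSr; apply: ler_pM => //.
  by apply: prodr_ge0 => j _; exact: ltW.
exact: ltW.
Qed.

Lemma blk_le_max i m n : (m <= n)%N -> blk i m <= B ^+ n.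
Proof. by move=> mn; apply: le_trans (blk_le _ _) _; rewrite ler_weXn2l. Qed.

(** The block from -N to N is a block up to [i] of length at most 2N, hence bounded by B^(2N), times
    the block from [i] to N. The lower bound is therefore uniform in [i]. *)
Lemma blk_lower N i : (`|i| <= N)%N ->
  exists2 k : nat, i + k%:Z = N%:Z &
    (k <= 2 * N)%N /\ blk (- N%:Z) (2 * N) / B ^+ (2 * N) <= blk i k.
Proof.
move=> iN; exists `|N%:Z - i|%N; first by lia.
set k := `|_|%N; split; first by lia.
rewrite ler_pdivrMr; last by exact: exprn_gt0.
pose l := `|(i + N%:Z)%R|%N; have -> : (2 * N = l + k)%N by lia.
rewrite blkD (_ : - N%:Z + l%:Z = i); last by lia.
by rewrite mulrC ler_wpM2l ?blk_le_max ?leq_addr // ltW ?blk_gt0.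
Qed.

Lemma blk_lower_gt0 N : 0 < blk (- N%:Z) (2 * N) / B ^+ (2 * N).
Proof. by rewrite divr_gt0 ?blk_gt0 // exprn_gt0. Qed.

(** The block of length n + N ending at [i], extended up to N, contains the block of length n ending
    at 0 and at most 3N weights besides. The extension is bounded below uniformly in [i], so one
    time serves all |i| <= N. *)
Lemma blk_small_from N : (forall e, 0 < e -> exists n : nat, blk (- n%:Z) n < e) ->
  forall e, 0 < e -> exists p : nat, forall i : int, (`|i| <= N)%N ->
    blk (i - p%:Z) p <= e.
Proof.
move=> small e e0; have c0 := blk_lower_gt0 N; set c := _ / _ in c0.
have BN : 0 < B ^+ (3 * N) by exact: exprn_gt0.
have [|n vn] := small (e * c / B ^+ (3 * N)); first by apply: divr_gt0 => //; exact: mulr_gt0.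
exists (n + N)%N => i iN; have [k ik [kN ck]] := blk_lower iN.
rewrite -/c in ck; have b0 j m := ltW (blk_gt0 j m).
rewrite -(ler_pM2r c0).
apply: le_trans (_ : blk (i - (n + N)%N%:Z) (n + N) * blk i k <= _).
  by rewrite ler_wpM2l.
have {2}-> : i = i - (n + N)%N%:Z + (n + N)%N%:Z by rewrite subrK.
rewrite -blkD [(n + N + k)%N]addnC blkD.
rewrite (_ : _ + k%:Z = - n%:Z); last by lia.
rewrite blkD mulrCA (_ : - n%:Z + n%:Z = 0); last by lia.
rewrite -[leRHS](@divfK _ (B ^+ (3 * N))) ?gt_eqF //.
apply: ler_pM; rewrite ?mulr_ge0 //; first exact: ltW.
rewrite (_ : 3 * N = 2 * N + N)%N ?(exprD B (2 * N)); last by lia.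
by apply: ler_pM => //; [exact: blk_le_max | exact: blk_le].
Qed.

(** The block from -(m + N) to N contains the small block of length m ending at [i] and at most 4N
    further weights; dividing by the fixed [blk 0 N] leaves a block ending at 0. *)
Lemma blk_small_origin i : (forall e, 0 < e -> exists n : nat, blk (i - n%:Z) n < e) ->
  forall e, 0 < e -> exists n : nat, blk (- n%:Z) n < e.
Proof.
move=> small e e0; pose N := `|i|%N; have b0 j m := ltW (blk_gt0 j m).
have BN : 0 < B ^+ (4 * N) by exact: exprn_gt0.
have c0 := blk_gt0 0 N.
have [|m vm] := small (e * blk 0 N / B ^+ (4 * N)); first by apply: divr_gt0 => //; exact: mulr_gt0.
have [k ik [kN _]] := @blk_lower N i (leqnn _).
exists (m + N)%N; rewrite -(ltr_pM2r c0).
rewrite -{1}[0](_ : - (m + N)%N%:Z + (m + N)%N%:Z = _); last by rewrite addNr.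
rewrite -blkD; pose l := `|(i + N%:Z)%R|%N.
rewrite (_ : m + N + N = l + (m + k))%N; last by lia.
rewrite blkD (_ : - (m + N)%N%:Z + l%:Z = i - m%:Z); last by lia.
rewrite blkD subrK mulrCA -[ltRHS](@divfK _ (B ^+ (4 * N))) ?gt_eqF //.
apply: le_lt_trans (_ : blk (i - m%:Z) m * B ^+ (4 * N) < _); last by rewrite ltr_pM2r.
rewrite ler_wpM2l // (_ : 4 * N = 2 * N + 2 * N)%N ?(exprD B (2 * N)); last by lia.
by apply: ler_pM => //; apply: blk_le_max; lia.
Qed.

(* If only finitely many starting points carried large blocks, extending such a
   block to the right up to N+1 would change it by a bounded factor. *)
Lemma blk_big_far : (forall C, exists k n, C < blk k n) ->
  forall C (N : nat), exists (i : int) (m : nat), (N < `|i|)%N /\ C < blk (i - m%:Z) m.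
Proof.
move=> big C N; have c0 := blk_lower_gt0 N.+1; set c := _ / _ in c0.
(* The threshold serves both cases: |C| if the block already ends far out, |C| / c if it must be
   extended to N + 1. *)
have [k [n kn]] := big (`|C| + `|C| / c).
have C0 : 0 <= `|C| / c by rewrite divr_ge0 // ltW.
have [Nk|kN] := ltnP N `|(k + n%:Z)%R|.
  exists (k + n%:Z), n; split => //; rewrite addrK.
  by apply: le_lt_trans kn; rewrite (le_trans (ler_norm _)) // lerDl.
have [m' km [_ cm]] := blk_lower (leqW kN); rewrite -/c in cm.
exists N.+1%:Z, (n + m')%N; split => //.
rewrite (_ : N.+1%:Z - _ = k); last by lia.
rewrite blkD; apply: lt_le_trans (_ : blk k n * c <= _); last first.
  by rewrite ler_wpM2l // ltW ?blk_gt0.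
rewrite -ltr_pdivrMr //; apply: le_lt_trans kn.
by apply: le_trans (_ : `|C| / c <= _); rewrite ?lerDr // ler_wpM2r ?ler_norm // invr_ge0 ltW.
Qed.

End WeightBlocks.

(** * Norm estimates for sequences over a field with a real-valued modulus *)

Section WeightedShift.
Variables (R : realType) (sp : seqspace R) (K : fieldType) (nabs : K -> R).
Variable emb : {rmorphism R -> K}.
Hypotheses (vsp : valid_space sp)
  (nabs_eq0 : forall x, nabs x = 0 -> x = 0)
  (nabsM : forall x y, nabs (x * y) = nabs x * nabs y)
  (nabsD : forall x y, nabs (x + y) <= nabs x + nabs y)
  (nabs_emb : forall r, nabs (emb r) = `|r|).
Implicit Types (x y z : int -> K) (e : R).

Lemma nabs0 : nabs 0 = 0. Proof. by rewrite -(rmorph0 emb) nabs_emb normr0. Qed.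
Lemma nabs1 : nabs 1 = 1. Proof. by rewrite -(rmorph1 emb) nabs_emb normr1. Qed.

Lemma nabsN v : nabs (- v) = nabs v.
Proof. by rewrite -mulN1r nabsM -(rmorph1 emb) -rmorphN nabs_emb normrN1 mul1r. Qed.

Lemma nabs_ge0 v : 0 <= nabs v.
Proof. by have := nabsD v (- v); rewrite subrr nabs0 nabsN => ?; lra. Qed.

Lemma nabs_gt0 v : v != 0 -> 0 < nabs v.
Proof.
move=> v0; rewrite lt_def nabs_ge0 andbT; apply: contraNN v0 => /eqP h.
by apply/eqP; exact: nabs_eq0.
Qed.

Lemma nabsX v n : nabs (v ^+ n) = nabs v ^+ n.
Proof. by elim: n => [|n IH]; rewrite ?nabs1 // !exprS nabsM IH. Qed.

Notation NX := (nrm nabs sp).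
Notation IX := (inX nabs sp).

Lemma nrmE x : NX x = mod_nrm sp (fun i => nabs (x i)).
Proof. by rewrite /mod_nrm; case: sp. Qed.

Lemma inXE x : IX x = mod_inX sp (fun i => nabs (x i)).
Proof. by rewrite /mod_inX; case: sp. Qed.

Lemma nrm_ge0 x : 0 <= NX x.
Proof. by rewrite nrmE mod_nrm_ge0 // => i; exact: nabs_ge0. Qed.

Lemma nabs_le_nrm x i : IX x -> nabs (x i) <= NX x.
Proof.
rewrite nrmE inXE => h.
exact: (@le_mod_nrm R sp (fun i => nabs (x i)) i vsp (fun i => nabs_ge0 _) h).
Qed.

Lemma nrm_dom x y A (c : int) : 0 <= A ->
  (forall i, nabs (y i) <= A * nabs (x (i + c))) -> IX x ->
  IX y /\ NX y <= A * NX x.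
Proof.
move=> A0 le; rewrite !inXE !nrmE => xX.
apply: (@mod_nrm_dom R sp _ _ A c vsp A0 _ _ xX) => i; rewrite nabs_ge0 //; exact: le.
Qed.

Lemma nrmD3 x y z : (forall i, nabs (z i) <= nabs (x i) + nabs (y i)) ->
  IX x -> IX y -> IX z /\ NX z <= 4 * (NX x + NX y).
Proof.
move=> le; rewrite !inXE !nrmE => xX yX.
by apply: (@mod_nrmD R sp _ _ _ vsp _ _ _ xX yX) => i; rewrite nabs_ge0 //; exact: le.
Qed.

Lemma inXD x y : IX x -> IX y -> IX (fun i => x i + y i).
Proof. by move=> xX yX; case: (@nrmD3 x y (fun i => x i + y i)). Qed.

Lemma inXZ c x : IX x -> IX (fun i => c * x i) /\ NX (fun i => c * x i) <= nabs c * NX x.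
Proof.
by apply: (@nrm_dom _ _ _ 0); rewrite ?nabs_ge0 // => i; rewrite nabsM addr0.
Qed.

Lemma inXB x y : IX x -> IX y -> IX (x \- y).
Proof.
by move=> xX yX; apply: (proj1 (@nrmD3 x y _ _ xX yX)) => i /=; rewrite -(nabsN (y i)).
Qed.

Lemma nrm_sparse x (t : nat -> int) A : 0 <= A -> injective t ->
  (forall i, ~ range t i -> x i = 0) ->
  (forall k, nabs (x (t k)) <= A * 2^-1 ^+ k) -> IX x /\ NX x <= 2 * A.
Proof.
move=> A0 ti x0 le; rewrite inXE nrmE.
apply: (@mod_nrm_sparse R sp _ t A vsp A0 ti) => [i /x0 ->|k]; first by rewrite nabs0.
by rewrite nabs_ge0 le.
Qed.

Lemma inX_single (i0 : int) : IX (fun i => (i0 == i)%:R).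
Proof.
apply: (proj1 (@nrm_sparse _ (fun k => i0 + k%:Z) 1 _ _ _ _)) => //.
- by move=> j k /addrI [].
- by move=> i h; case: eqP => // E; case: h; exists 0%N => //; rewrite addr0.
move=> [|k]; first by rewrite addr0 eqxx nabs1 expr0 mulr1.
rewrite (_ : (_ == _) = false) ?nabs0 ?mulr_ge0 ?exprn_ge0 ?invr_ge0 //.
by apply/negbTE/eqP; lia.
Qed.

Lemma inX_sum n (c : nat -> K) (d : nat -> int) :
  IX (fun i => \sum_(j < n) c j * (d j == i)%:R).
Proof.
elim: n => [|n IH].
  rewrite (_ : (fun _ => _) = (fun i => 0 * (0 == i)%:R)).
    exact: (proj1 (inXZ _ (inX_single _))).
  by apply/funext => i; rewrite big_ord0 mul0r.
under eq_fun do rewrite big_ord_recr /=.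
by apply: inXD IH _; exact: (proj1 (inXZ _ (inX_single _))).
Qed.

(** * Orbits of the shift in terms of block products *)

Section Orbits.
Variables (w : int -> K) (B : R).
Hypotheses (B1 : 1 <= B) (w_le : forall i, nabs (w i) <= B) (w_neq0 : forall i, w i != 0).
Let a i := nabs (w i).
Let a_gt0 i : 0 < a i. Proof. exact: nabs_gt0. Qed.
Let a_le i : a i <= B. Proof. exact: w_le. Qed.
Local Notation T := (Bw w).
Local Notation W := (blk a).

Lemma iter_BwE n x i :
  iter n T x i = (\prod_(0 <= j < n) w (i + 1 + j%:Z)) * x (i + n%:Z).
Proof.
elim: n x i => [|n IH] x i; first by rewrite big_nil mul1r addr0.
rewrite iterSr IH /Bw big_nat_recr //= -mulrA; congr (_ * (w _ * x _)); lia.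
Qed.

Lemma nabs_iter n x i : nabs (iter n T x i) = W i n * nabs (x (i + n%:Z)).
Proof.
rewrite iter_BwE nabsM; congr (_ * _); rewrite /blk.
by elim: n => [|n IH]; rewrite ?big_nil ?nabs1 // !big_nat_recr //= nabsM IH.
Qed.

Lemma iter_BwB n x y : iter n T x \- iter n T y = iter n T (x \- y).
Proof. by apply/funext => i /=; rewrite !iter_BwE mulrBr. Qed.

Lemma iter_Bw_nrm n x C : (forall i, W i n <= C) -> IX x ->
  IX (iter n T x) /\ NX (iter n T x) <= C * NX x.
Proof.
move=> le; apply: (@nrm_dom _ _ _ n%:Z).
  by apply: le_trans (le 0); exact: ltW (blk_gt0 a_gt0 _ _).
by move=> i; rewrite nabs_iter ler_wpM2r ?nabs_ge0.
Qed.

Lemma inX_iter n x : IX x -> IX (iter n T x).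
Proof. by move=> xX; apply: (proj1 (@iter_Bw_nrm n x (B ^+ n) _ xX)) => i; exact: blk_le. Qed.

Lemma nrm_iter_ge n x i : IX x -> W (i - n%:Z) n * nabs (x i) <= NX (iter n T x).
Proof.
move=> xX; have -> : x i = x (i - n%:Z + n%:Z) by rewrite subrK.
rewrite -nabs_iter.
exact/nabs_le_nrm/inX_iter.
Qed.

Lemma neq0_coord x : x <> (fun _ => 0) -> exists i, x i != 0.
Proof.
move=> x0; apply: contrapT => no; apply: x0; apply/funext => i.
by apply/eqP; apply: contrapT => /negP xi; apply: no; exists i.
Qed.

(** Nonzero weights make the shift injective; this supplies the positivity that [limn_einf_eq0] asks
    for. *)
Lemma nrm_iter_gt0 n x : IX x -> x <> (fun _ => 0) -> 0 < NX (iter n T x).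
Proof.
move=> xX /neq0_coord [i xi].
apply: lt_le_trans (nrm_iter_ge n i xX).
by rewrite mulr_gt0 ?nabs_gt0 // blk_gt0.
Qed.

Definition decays (r : nat -> R) :=
  forall e, 0 < e -> exists m, forall n, (m <= n)%N -> r n <= e.

(** The common weakening of an irregular vector and of the difference of a scrambled pair: the orbit
    need only fail to tend to 0. *)
Definition semi_irregular z := [/\ IX z, z <> (fun _ => 0),
  forall e, 0 < e -> exists n, NX (iter n T z) < e &
  ~ decays (fun n => NX (iter n T z))].

Definition weights_oscillate :=
  (forall e, 0 < e -> exists n : nat, W (- n%:Z) n < e) /\
  (forall C, exists k n, C < W k n).

Lemma semi_irregular_weights z : semi_irregular z -> weights_oscillate.
Proof.
move=> [zX z0 small ndec]; have b0 k n := blk_gt0 a_gt0 k n; split.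
  have [i zi] := neq0_coord z0.
  apply: (@blk_small_origin R a B B1 a_gt0 a_le i) => e e0.
  have [|n hn] := small (e * nabs (z i)); first by rewrite mulr_gt0 ?nabs_gt0.
  exists n; rewrite -(ltr_pM2r (nabs_gt0 zi)).
  exact: le_lt_trans (nrm_iter_ge n i zX) hn.
apply: contrapT => nb; apply: ndec => e e0.
have [C hC] : exists C, forall k n, W k n <= C.
  apply: contrapT => h; apply: nb => C; apply: contrapT => h'; apply: h; exists C => k n.
  by rewrite leNgt; apply/negP => lt; apply: h'; exists k, n.
have C0 : 0 < C by exact: lt_le_trans (b0 0 0%N) (hC 0 0%N).
(* Once the norm is below e / C it stays at most e, since further powers multiply it by at most
   C. *)
have [|m hm] := small (e / C); first by rewrite divr_gt0.
exists m => n mn; rewrite -(subnK mn) iterD.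
have [_ le] := @iter_Bw_nrm (n - m) _ C (fun i => hC i _) (inX_iter m zX).
by apply: le_trans le _; rewrite mulrC -ler_pdivlMr // ltW.
Qed.


(* [pv N] is a time at which every e_i with |i| <= N has become small; [d] lists
   each integer infinitely often; [F k N] is a pair (i, m) with |i| > N for which
   T^m e_i is huge compared with all the data chosen before.  [vec] is the linear
   map from polynomials sending X^j to e_(d j) + sum_k coefficient_k node_k^j e_(site k).
   Letting the perturbation of e_(d j) decay geometrically in j gives density, and
   reading off the coordinate [site k] of [vec P] gives coefficient_k P(node_k), which
   for P != 0 is bounded below by a constant multiple of coefficient_k node_k^k. *)
Section Construction.
Variables (pv : nat -> nat) (d : nat -> int) (F : nat -> nat -> int * nat).

Let h : R := 2^-1.
(** Summing the exponents makes this dominate [B ^+ pv n] for all n <= N at once. *)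
Definition damp N := B ^+ (\sum_(n < N.+1) pv n).
(** One factor [h ^+ k] gives summability over the sites, the other smallness along the times [pv];
    [damp] offsets the growth at the times attached to earlier sites. *)
Definition amp k N : R := h ^+ k * h ^+ k / damp N.
(** The exponent k+1 keeps every node at most 1/2, so that the values of X^l at the nodes tend to 0
    uniformly as l grows; density rests on this. *)
Definition node k : R := h ^+ k.+1.

Hypotheses
  (pv_small : forall N (i : int), (`|i| <= N)%N -> W (i - (pv N)%:Z) (pv N) <= h ^+ N)
  (d_often : forall i J, exists2 j, (J <= j)%N & d j = i)
  (F_far : forall k N, (N < `|(F k N).1|)%N /\
     k%:R / (amp k N * node k ^+ k) < W ((F k N).1 - (F k N).2%:Z) (F k N).2).

Fixpoint stage k : int * nat :=
  if k is k'.+1 then F k (`|(stage k').1|%N) else F 0 0.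
(** The bound under which [F] is called at stage [k]; through it the coefficient at [k] can allow
    for every earlier site. *)
Definition prev k : nat := if k is k'.+1 then `|(stage k').1|%N else 0%N.
Definition site k := (stage k).1.

Lemma stageE k : stage k = F k (prev k). Proof. by case: k. Qed.

Lemma site_lt j k : (j < k)%N -> (`|site j| < `|site k|)%N.
Proof.
elim: k => // k IH; rewrite ltnS leq_eqVlt => jk.
have lt : (`|site k| < `|site k.+1|)%N by rewrite /site [stage k.+1]stageE; exact: (F_far k.+1 _).1.
by case/orP: jk => [/eqP -> //|/IH /ltn_trans]; apply.
Qed.

Lemma site_ge k : (k <= `|site k|)%N.
Proof. by elim: k => // k /leq_ltn_trans; apply; exact: site_lt. Qed.

Lemma site_le_prev j k : (j < k)%N -> (`|site j| <= prev k)%N.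
Proof.
case: k => // k; rewrite ltnS leq_eqVlt => /orP[/eqP -> //|/site_lt]; exact: ltnW.
Qed.

Lemma site_inj : injective site.
Proof.
move=> j k E; have [lt|lt|//] := ltngtP j k.
  by have := site_lt lt; rewrite E ltnn.
by have := site_lt lt; rewrite E ltnn.
Qed.

Lemma h_bounds k : 0 < h ^+ k <= 1.
Proof. by rewrite exprn_gt0 ?invr_gt0 //= exprn_ile1 // ?invr_ge0 // invf_le1 // ler1n. Qed.

Lemma geom_small C e : 0 < e -> exists m, forall k, (m <= k)%N -> C * h ^+ k <= e.
Proof.
move=> e0; have := @cvg_geometric R C h.
rewrite ger0_norm ?invr_ge0 // invf_lt1 // ltr1n => /(_ isT).
move=> /cvgr0Pnorm_lt /(_ _ e0) [m _ hm]; exists m => k mk.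
exact/ltW/(le_lt_trans (ler_norm _) (hm k mk)).
Qed.

Lemma damp_ge1 N : 1 <= damp N. Proof. exact: exprn_ege1. Qed.

Definition coefficient k := amp k (prev k).

Lemma amp_bounds k N : 0 < amp k N <= h ^+ k * h ^+ k.
Proof.
have /andP[h0 h1] := h_bounds k; have D1 := damp_ge1 N.
have D0 : 0 < damp N by lra.
rewrite /amp divr_gt0 ?mulr_gt0 //= ler_pdivrMr // ler_peMr // ltW ?mulr_gt0 //.
Qed.

(** As |site j| <= [prev k], the exponent on the left is one of those summed in [damp (prev k)], by
    which the coefficient is divided. *)
Lemma coefficient_damped j k : (j < k)%N ->
  B ^+ pv `|site j| * coefficient k <= h ^+ k * h ^+ k.
Proof.
move=> jk; have /andP[h0 h1] := h_bounds k; have D1 := damp_ge1 (prev k).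
have D0 : 0 < damp (prev k) by lra.
rewrite /coefficient /amp mulrA ler_pdivrMr // mulrC ler_wpM2l ?mulr_ge0 ?(ltW h0) //.
rewrite ler_weXn2l //; have := site_le_prev jk; rewrite -ltnS => lt.
by rewrite (bigD1 (Ordinal lt)) //= leq_addr.
Qed.

(** The formal sum over all sites, made finite by k <= |site k|: only indices k <= |i| can have
    [site k] equal to [i]. *)
Definition spike (P : {poly K}) i : K :=
  \sum_(k < `|i|.+1 | site k == i) emb (coefficient k) * P.[emb (node k)].

Definition core (P : {poly K}) i : K := \sum_(j < size P) P`_j * (d j == i)%:R.

Definition vec P i := core P i + spike P i.

Lemma spike_site P k : spike P (site k) = emb (coefficient k) * P.[emb (node k)].
Proof.
have lt : (k < `|site k|.+1)%N by rewrite ltnS site_ge.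
rewrite /spike (bigD1 (Ordinal lt)) //= big1 ?addr0 // => j /andP[/eqP /site_inj E].
by rewrite -val_eqE /= E eqxx.
Qed.

Lemma spike_off P i : ~ range site i -> spike P i = 0.
Proof.
by move=> ni; rewrite /spike big1 // => j /eqP E; case: ni; exists (nat_of_ord j).
Qed.

Lemma coreE (P : {poly K}) i n : (size P <= n)%N -> core P i = \sum_(j < n) P`_j * (d j == i)%:R.
Proof.
move=> Pn; rewrite /core (big_ord_widen n (fun j => P`_j * (d j == i)%:R)) //.
rewrite [RHS](bigID (fun j : 'I_n => (j < size P)%N)) /= [X in _ + X]big1 ?addr0 //.
by move=> j; rewrite -leqNgt => /(nth_default 0) ->; rewrite mul0r.
Qed.

Lemma vec_linear c (P Q : {poly K}) i : vec (c *: P + Q) i = c * vec P i + vec Q i.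
Proof.
rewrite /vec; pose n := maxn (size (c *: P + Q)) (maxn (size P) (size Q)).
rewrite !(@coreE _ i n); try by rewrite /n; lia.
have -> : spike (c *: P + Q) i = c * spike P i + spike Q i.
  rewrite /spike mulr_sumr -big_split; apply: eq_bigr => k _ /=.
  by rewrite hornerD hornerZ; ring.
have -> : \sum_(j < n) (c *: P + Q)`_j * (d j == i)%:R =
  c * (\sum_(j < n) P`_j * (d j == i)%:R) + \sum_(j < n) Q`_j * (d j == i)%:R.
  rewrite mulr_sumr -big_split; apply: eq_bigr => k _ /=.
  by rewrite coefD coefZ; ring.
ring.
Qed.

Lemma vec0 i : vec 0 i = 0.
Proof.
rewrite /vec /core size_poly0 big_ord0 add0r /spike big1 // => k _.
by rewrite horner0 mulr0.
Qed.

Lemma vecXn j i : vec 'X^j i = (d j == i)%:R + spike 'X^j i.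
Proof.
congr (_ + _); rewrite /core size_polyXn (bigD1 ord_max) //= coefXn eqxx mul1r big1 ?addr0 //.
by move=> k; rewrite -val_eqE /= coefXn => /negbTE ->; rewrite mul0r.
Qed.

(** Bounds P at all nodes at once, since they lie in (0, 1]. *)
Definition poly_bound (P : {poly K}) := \sum_(j < size P) nabs P`_j.

Lemma poly_bound_ge0 P : 0 <= poly_bound P.
Proof. by apply: sumr_ge0 => j _; exact: nabs_ge0. Qed.

Lemma nabs_sum n (g : nat -> K) : nabs (\sum_(j < n) g j) <= \sum_(j < n) nabs (g j).
Proof.
elim: n => [|n IH]; first by rewrite !big_ord0 nabs0.
by rewrite !big_ord_recr /=; apply: le_trans (nabsD _ _) _; rewrite lerD2r.
Qed.

Lemma horner_node_le P k : nabs P.[emb (node k)] <= poly_bound P.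
Proof.
rewrite horner_coef; apply: le_trans (@nabs_sum _ (fun j => P`_j * emb (node k) ^+ j)) _.
apply: ler_sum => j _; have /andP[n0 n1] := h_bounds k.+1.
rewrite nabsM nabsX nabs_emb ger0_norm; last exact: ltW.
by rewrite ler_piMr ?nabs_ge0 // exprn_ile1 // ltW.
Qed.

(* Near 0 the lowest order term of P dominates. *)
Lemma horner_node_ge (P : {poly K}) : P != 0 ->
  exists2 c, 0 < c & exists m, forall k, (m <= k)%N ->
    c * node k ^+ k <= nabs P.[emb (node k)].
Proof.
move=> P0; suff [c c0 [r [m hm]]] : exists2 c, 0 < c & exists r m, forall k, (m <= k)%N ->
    c * node k ^+ r <= nabs P.[emb (node k)].
  (* Replacing the exponent r by k weakens the bound but makes its exponent independent of P, so
     that [F] can be chosen before P. *)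
  exists c => //; exists (maxn r m) => k; rewrite geq_max => /andP[rk mk].
  apply: le_trans (hm k mk); rewrite ler_pM2l //; have /andP[n0 n1] := h_bounds k.+1.
  by apply: ler_wiXn2l => //; exact: ltW.
elim/poly_ind: P P0 => [|Q u IH]; first by rewrite eqxx.
move=> QX0; have [u0|u0] := eqVneq u 0.
  have Q0 : Q != 0 by apply: contraNneq QX0 => ->; rewrite u0 mul0r addr0.
  have [c c0 [r [m hm]]] := IH Q0; exists c => //; exists r.+1, m => k mk.
  have /andP[n0 n1] := h_bounds k.+1.
  rewrite u0 addr0 hornerMX nabsM nabs_emb (ger0_norm (ltW n0)).
  by rewrite exprSr mulrA ler_wpM2r ?hm // ltW.
exists (nabs u / 2); first by rewrite divr_gt0 ?nabs_gt0.
have u1 := nabs_gt0 u0; have M0 := poly_bound_ge0 Q.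
have [m hm] : exists m, forall k, (m <= k)%N -> poly_bound Q * node k <= nabs u / 2.
  have [|m hm] := @geom_small (poly_bound Q) (nabs u / 2); first by lra.
  by exists m => k mk; apply: hm; exact: leqW.
exists 0%N, m => k /hm mk; have /andP[n0 n1] := h_bounds k.+1.
rewrite expr0 mulr1 hornerMXaddC.
have le1 : nabs (Q.[emb (node k)] * emb (node k)) <= poly_bound Q * node k.
  by rewrite nabsM nabs_emb (ger0_norm (ltW n0)) ler_wpM2r ?horner_node_le // ltW.
have := nabsD (Q.[emb (node k)] * emb (node k) + u) (- (Q.[emb (node k)] * emb (node k))).
rewrite addrAC subrr add0r nabsN => ?; lra.
Qed.

(** The coefficient at [k] is at most [h ^+ k], so the entries decay geometrically along the
    sites. *)
Lemma spike_nrm P A : 0 <= A -> (forall k, nabs P.[emb (node k)] <= A) ->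
  IX (spike P) /\ NX (spike P) <= 2 * A.
Proof.
move=> A0 le; apply: (@nrm_sparse _ site) => //; first exact: site_inj.
  exact: spike_off.
move=> k; rewrite spike_site nabsM nabs_emb.
have /andP[e0 e1] := amp_bounds k (prev k); rewrite -/(coefficient k) in e0 e1 *.
have /andP[h0 h1] := h_bounds k; rewrite (ger0_norm (ltW e0)) mulrC.
apply: ler_pM => //; [exact: nabs_ge0|exact: ltW|].
by apply: le_trans e1 _; rewrite ler_piMr // ltW.
Qed.

Lemma inX_vec P : IX (vec P).
Proof.
apply: inXD; first exact: inX_sum.
by apply: (proj1 (spike_nrm (poly_bound_ge0 P) _)) => k; exact: horner_node_le.
Qed.

Lemma core_support P : exists N : nat, forall i : int, (N < `|i|)%N -> core P i = 0.
Proof.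
exists (\sum_(j < size P) `|d j|)%N => i lt; rewrite /core big1 // => j _.
case: eqP => [E|]; last by rewrite mulr0.
by move: lt; rewrite -E (bigD1 j) //= ltnNge leq_addr.
Qed.

Lemma vec_big P : P != 0 ->
  forall A, exists m, forall k, (m <= k)%N -> A < NX (iter (stage k).2 T (vec P)).
Proof.
move=> P0 A; have [c c0 [m hm]] := horner_node_ge P0.
have [N hN] := core_support P.
(* Beyond [m] the lower bound on P holds, beyond N the site lies outside the support of the core,
   and the last entry ensures A < c k, where c k is a lower bound for the coordinate read off
   below. *)
exists (maxn m (maxn N.+1 (Num.truncn (A / c)).+1)) => k.
rewrite !geq_max => /andP[mk /andP[Nk Ak]].
have /andP[e0 _] := amp_bounds k (prev k).
have n0 : 0 < node k ^+ k by rewrite exprn_gt0 //; case/andP: (h_bounds k.+1).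
apply: lt_le_trans (nrm_iter_ge _ (site k) (inX_vec P)).
rewrite /vec hN ?add0r; last exact: leq_trans Nk (site_ge k).
rewrite spike_site nabsM nabs_emb /coefficient (ger0_norm (ltW e0)).
have := (F_far k (prev k)).2; rewrite -stageE -/(site k).
rewrite ltr_pdivrMr => [lt|]; last exact: mulr_gt0.
have W0 := blk_gt0 a_gt0 (site k - (stage k).2%:Z) (stage k).2.
apply: lt_le_trans (_ : c * k%:R <= _).
  rewrite mulrC -ltr_pdivrMr //; apply: lt_le_trans (truncnS_gt _) _.
  by rewrite ler_nat.
rewrite mulrA; apply: le_trans (_ : W (site k - (stage k).2%:Z) (stage k).2 *
  amp k (prev k) * (c * node k ^+ k) <= _).
  by rewrite mulrCA ler_pM2l // -mulrA ltW.
by rewrite ler_pM2l ?hm //; exact: mulr_gt0.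
Qed.

(** The orbit is split by source coordinate. Sources within |site k| are damped by the choice of
    [pv]; beyond them, for large k, only later spikes occur, and their coefficients absorb even the
    crude bound [B ^+ n]. *)
Lemma vec_small P : decays (fun k => NX (iter (pv `|site k|) T (vec P))).
Proof.
move=> e e0; set A := poly_bound P; have A0 : 0 <= A := poly_bound_ge0 P.
have [N hN] := core_support P; have xX := inX_vec P.
(* The constants are those that [nrmD3] yields from the bounds on the two pieces [y1] and [y2]. *)
have [m hm] := geom_small (4 * NX (vec P) + 8 * A) e0.
exists (maxn m N) => k; rewrite geq_max => /andP[/hm le Nk].
apply: le_trans le; set n := pv _; set y := iter n T (vec P).
have /andP[h0 h1] := h_bounds k.
pose y1 i := if (`|(i + n%:Z)%R| <= `|site k|)%N then y i else 0.
pose y2 i := if (`|(i + n%:Z)%R| <= `|site k|)%N then 0 else y i.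
have [y1X y1le] : IX y1 /\ NX y1 <= h ^+ k * NX (vec P).
  apply: (@nrm_dom _ _ _ n%:Z) xX => [|i]; first exact: ltW.
  rewrite /y1; case: ifP => [le|_]; last by rewrite nabs0 mulr_ge0 ?nabs_ge0 // ltW.
  rewrite nabs_iter ler_wpM2r ?nabs_ge0 //.
  have := pv_small le; rewrite addrK => /le_trans; apply.
  by apply: ler_wiXn2l; rewrite ?site_ge ?invr_ge0 ?invf_le1 ?ler1n.
have [y2X y2le] : IX y2 /\ NX y2 <= 2 * (h ^+ k * A).
  apply: (@nrm_sparse _ (fun l => site l - n%:Z)).
  - by rewrite mulr_ge0 // ltW.
  - by move=> l l' /addIr /site_inj.
  - move=> i ni; rewrite /y2; case: leqP => // lt; rewrite /y iter_BwE /vec hN.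
      rewrite spike_off ?add0r ?mulr0 // => -[l _ E]; apply: ni; exists l => //.
      by rewrite E addrK.
    exact: leq_ltn_trans (leq_trans Nk (site_ge k)) lt.
  move=> l; have /andP[l0 l1] := h_bounds l.
  rewrite /y2 subrK; case: leqP => [_|lt].
    by rewrite nabs0 ?mulr_ge0 // ltW.
  have kl : (k < l)%N.
    by rewrite ltnNge; apply/negP; rewrite leq_eqVlt => /orP[/eqP E|/site_lt E];
      move: lt; rewrite ?E ?ltnn // ltnNge ltnW.
  rewrite nabs_iter subrK /vec hN ?add0r; last first.
    exact: leq_ltn_trans (leq_trans Nk (site_ge k)) lt.
  have /andP[c0 _] := amp_bounds l (prev l); rewrite -/(coefficient l) in c0.
  rewrite spike_site nabsM nabs_emb (ger0_norm (ltW c0)) mulrA.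
  rewrite [leRHS]mulrAC; apply: ler_pM; rewrite ?nabs_ge0 ?horner_node_le //.
    by rewrite mulr_ge0 ?(ltW c0) // ltW ?blk_gt0.
  apply: le_trans (_ : B ^+ n * coefficient l <= _).
    by rewrite ler_wpM2r ?(ltW c0) // blk_le.
  apply: le_trans (coefficient_damped kl) _; rewrite ler_wpM2r ?(ltW l0) //.
  by apply: ler_wiXn2l; rewrite ?(ltnW kl) ?invr_ge0 ?invf_le1 ?ler1n.
have [|_ le] := @nrmD3 y1 y2 y _ y1X y2X; last lra.
by move=> i; rewrite /y1 /y2; case: ifP; rewrite nabs0 ?addr0 ?add0r.
Qed.

(** Each e_j in the sum is matched by X^l with [d l = j] and l large: the core of X^l is e_j itself,
    and its spike has norm at most 2 h^l. *)
Lemma vec_near_finite (s : seq int) (c : int -> K) e : 0 < e ->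
  exists P, NX (fun i => \sum_(j <- s) c j * (j == i)%:R - vec P i) <= e /\
            IX (fun i => \sum_(j <- s) c j * (j == i)%:R - vec P i).
Proof.
elim: s e => [|j s IH] e e0.
  exists 0; have -> : (fun i => \sum_(j <- [::]) c j * (j == i)%:R - vec 0 i) = vec 0.
    by apply/funext => i; rewrite big_nil vec0 subr0.
  have [] := @nrm_dom (vec 0) (vec 0) 0 0 (lexx 0) _ (inX_vec 0).
    by move=> i; rewrite vec0 nabs0 mul0r.
  by rewrite mul0r => vX le; split => //; apply: le_trans le (ltW e0).
(* Two errors of e / 8 become e under the constant 4 of [nrmD3]. *)
have [|P [Ple PX]] := IH (e / 8); first by lra.
have e8 : 0 < e / 8 by lra.
have [m hm] := geom_small (nabs (c j) * 2) e8.
have [l ml dl] := d_often j m.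
have [sX sle] : IX (spike 'X^l) /\ NX (spike 'X^l) <= 2 * h ^+ l.
  have /andP[l0 l1] := h_bounds l.
  apply: spike_nrm => [|k]; first exact: ltW.
  rewrite hornerXn nabsX nabs_emb; have /andP[k0 k1] := h_bounds k.
  rewrite ger0_norm ?exprn_ge0 ?invr_ge0 //.
  rewrite lerXn2r ?nnegrE ?exprn_ge0 ?invr_ge0 //.
  by rewrite /node exprS ler_piMr // ?invr_ge0.
have [cX cle] := inXZ (- c j) sX.
have E i : \sum_(j <- j :: s) c j * (j == i)%:R - vec (c j *: 'X^l + P) i =
  \sum_(j <- s) c j * (j == i)%:R - vec P i + - c j * spike 'X^l i.
  by rewrite big_cons vec_linear vecXn dl; ring.
exists (c j *: 'X^l + P); under eq_fun do rewrite E.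
have [zX zle] := @nrmD3 _ _ (fun i => \sum_(j <- s) c j * (j == i)%:R - vec P i +
  - c j * spike 'X^l i) (fun i => nabsD _ _) PX cX.
split => //; apply: le_trans zle _; rewrite nabsN in cle.
have := hm l ml; have := nabs_ge0 (c j) => c0 lm.
have : nabs (c j) * NX (spike 'X^l) <= nabs (c j) * (2 * h ^+ l) by rewrite ler_wpM2l.
rewrite mulrA; lra.
Qed.

Lemma vec_dense : dense_in_X nabs sp (range vec).
Proof.
(* The tail of [x] and the approximation of its finite part cost e / 16 each, hence at most e / 2
   together by [nrmD3]. *)
move=> x xX e e0; have e16 : 0 < e / 16 by lra.
have xX' : mod_inX sp (fun i => nabs (x i)) by rewrite -inXE.
have [N hN] := @mod_nrm_tail R sp _ _ vsp (fun i => nabs_ge0 (x i)) xX' e16.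
pose x2 i := if (`|i| <= N)%N then 0 else x i.
have x2le : NX x2 <= e / 16.
  rewrite nrmE; apply: le_trans hN; rewrite le_eqVlt; apply/orP; left; apply/eqP.
  by congr (mod_nrm sp _); apply/funext => i; rewrite /x2 /tail; case: ifP; rewrite ?nabs0.
have x2X : IX x2.
  apply: (proj1 (@nrm_dom x x2 1 0 ler01 _ xX)) => i.
  by rewrite /x2 mul1r addr0; case: ifP; rewrite ?nabs0 ?nabs_ge0.
pose s := [seq k%:Z - N%:Z | k <- iota 0 (2 * N).+1].
have [P [Ple PX]] := vec_near_finite s x e16.
exists (vec P); first by exists P.
have s_uniq : uniq s by rewrite map_inj_uniq ?iota_uniq // => k l /addIr [].
have s_mem i : (i \in s) = (`|i| <= N)%N.
  apply/mapP/idP => [[k + ->]|iN]; first by rewrite mem_iota; lia.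
  exists `|(i + N%:Z)%R|%N; last by lia.
  by rewrite mem_iota; lia.
have headE i : \sum_(j <- s) x j * (j == i)%:R = if (`|i| <= N)%N then x i else 0.
  rewrite -s_mem; case: ifPn => [si|nsi].
    rewrite (bigD1_seq i) //= eqxx mulr1 big1 ?addr0 // => j /negbTE ->.
    by rewrite mulr0.
  rewrite big1_seq // => j /andP[_ js]; case: eqP => [E|_]; last by rewrite mulr0.
  by rewrite -E js in nsi.
have [|_ le] := @nrmD3 _ _ (x \- vec P) _ x2X PX.
  move=> i /=; apply: le_trans (nabsD _ _); rewrite headE /x2.
  by case: ifP => _; rewrite ?addrA ?add0r ?addr0.
apply: le_lt_trans le _; lra.
Qed.

End Construction.


(** The times [p] and [q] are the same for all vectors of the subspace, as uniform chaos
    requires. *)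
Lemma irregular_witnesses : weights_oscillate -> exists M (p q : nat -> nat),
  [/\ vector_subspace nabs sp M, dense_in_X nabs sp M &
    forall z, M z -> z <> (fun _ => 0) -> decays (fun k => NX (iter (p k) T z)) /\
      forall A, exists m, forall k, (m <= k)%N -> A < NX (iter (q k) T z)].
Proof.
move=> [small big].
have /choice[pv pvP] : forall N, exists p : nat, forall i : int, (`|i| <= N)%N ->
    W (i - p%:Z) p <= 2^-1 ^+ N.
  move=> N; apply: (@blk_small_from R a B B1 a_gt0 a_le N small).
  by rewrite exprn_gt0 // invr_gt0.
have [d dP] : exists d : nat -> int, forall i J, exists2 j, (J <= j)%N & d j = i.
  (* The exponent of 2 in j encodes an integer, with 0 as default when it encodes none; the factor
     3^J makes j large without changing that exponent. *)
  exists (fun j => odflt 0 (unpickle (logn 2 j))) => i J.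
  exists (2 ^ pickle i * 3 ^ J)%N.
    apply: leq_trans (ltnW (ltn_expl J (isT : 1 < 3)%N)) _.
    by rewrite leq_pmull // expn_gt0.
  by rewrite lognM ?expn_gt0 // !lognX !logn_prime //= muln1 muln0 addn0 pickleK.
have /choice[F FP] : forall kN : nat * nat, exists im : int * nat, (kN.2 < `|im.1|)%N /\
    kN.1%:R / (amp pv kN.1 kN.2 * node kN.1 ^+ kN.1) < W (im.1 - im.2%:Z) im.2.
  move=> [k N]; have [i [m im]] := blk_big_far B1 a_gt0 a_le big
    (k%:R / (amp pv k N * node k ^+ k)) N.
  by exists (i, m).
pose F' k N := F (k, N); have F'P k N := FP (k, N).
pose M := range (vec pv d F').
exists M, (fun k => pv `|site F' k|%N), (fun k => (stage F' k).2); split.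
- split; first by move=> _ [P _ <-]; exact: inX_vec.
  split; first by exists 0 => //; apply/funext => i; exact: vec0.
  move=> c _ _ [P _ <-] [Q _ <-]; exists (c *: P + Q) => //.
  by apply/funext => i; rewrite vec_linear.
- exact: vec_dense.
move=> _ [P _ <-] P0; split; first exact: vec_small.
apply: vec_big => //; apply/eqP => E; apply: P0; rewrite E.
by apply/funext => i; exact: vec0.
Qed.

(** * From orbit behaviour to the chaos conditions and back *)

Lemma iter_Bw0 n : iter n T (fun _ => 0) = (fun _ => 0).
Proof. by apply/funext => i; rewrite iter_BwE mulr0. Qed.

Lemma nrm0_decays z : z = (fun _ => 0) -> IX z -> decays (fun n => NX (iter n T z)).
Proof.
move=> -> zX e e0; exists 0%N => n _; rewrite iter_Bw0.
have [] := @nrm_dom _ (fun _ => 0) 0 0 (lexx 0) _ zX.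
  by move=> i; rewrite nabs0 mul0r.
by rewrite mul0r => _ /le_trans; apply; exact: ltW.
Qed.

Lemma decays_bounded r : decays r -> exists C, forall n, r n <= C.
Proof.
move=> /(_ 1 ltr01) [m hm]; exists (1 + \sum_(j < m) `|r j|) => n.
have s0 : 0 <= \sum_(j < m) `|r j| by apply: sumr_ge0.
have [/hm le|nm] := leqP m n; first lra.
rewrite (bigD1 (Ordinal nm)) //=; have := ler_norm (r n).
have : 0 <= \sum_(j < m | j != Ordinal nm) `|r j| by apply: sumr_ge0.
lra.
Qed.

Lemma scrambled_semi_irregular x y :
  LY_scrambled_pair nabs sp T x y -> semi_irregular (x \- y).
Proof.
move=> [xX [yX]]; rewrite /orbit_dist; under eq_fun do rewrite iter_BwB.
move=> [/limn_einf_small small pos]; have zX := inXB xX yX.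
have nd : ~ decays (fun n => NX (iter n T (x \- y))).
  by move=> /limn_esup_le0; rewrite leNgt pos.
by split=> // z0; exact: nd (nrm0_decays z0 zX).
Qed.

Lemma irregular_semi_irregular z : IX z -> irregular nabs sp T z -> semi_irregular z.
Proof.
move=> zX [/limn_einf_small small big].
have nd : ~ decays (fun n => NX (iter n T z)) by move=> /limn_esup_le0; rewrite big.
by split=> // z0; exact: nd (nrm0_decays z0 zX).
Qed.

Lemma irregular_of_sequences z (p q : nat -> nat) : IX z -> z <> (fun _ => 0) ->
  decays (fun k => NX (iter (p k) T z)) ->
  (forall A, exists m, forall k, (m <= k)%N -> A < NX (iter (q k) T z)) ->
  irregular nabs sp T z.
Proof.
move=> zX z0 small big; split.
  apply: limn_einf_eq0 => [n|e e0]; first exact: nrm_iter_gt0.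
  have [|m hm] := small (e / 2); first by rewrite divr_gt0.
  by exists (p m); apply: le_lt_trans (hm m (leqnn _)) _; lra.
by apply: limn_esup_eqy => A; have [m hm] := big A; exists (q m); exact: hm.
Qed.

(** A vector at distance less than 1 from e_0 is not 0, because e_0 has norm at least 1. *)
Lemma nonzero_of_dense M : dense_in_X nabs sp M -> exists2 z, M z & z <> (fun _ => 0).
Proof.
move=> dM; have [z Mz lt] := dM _ (inX_single 0) 1 ltr01; exists z => // z0.
move: lt; rewrite z0 ltNge => /negP; apply.
have E : (fun i : int => (0 == i)%:R) \- (fun _ => 0) = (fun i : int => (0 == i)%:R) :> (int -> K).
  by apply/funext => i /=; rewrite subr0.
by rewrite E; have := nabs_le_nrm 0 (inX_single 0); rewrite eqxx nabs1.
Qed.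

Lemma subr_fun_neq0 x y : x <> y -> x \- y <> (fun _ => 0).
Proof.
by move=> xy E; apply: xy; apply/funext => i; apply/eqP; rewrite -subr_eq0 -[_ - _]/((x \- y) i) E.
Qed.

Lemma subspaceB M x y : vector_subspace nabs sp M -> M x -> M y -> M (x \- y).
Proof.
move=> [_ [_ lin]] Mx My; have := lin (-1) y x My Mx; congr M.
by apply/funext => i /=; rewrite mulN1r addrC.
Qed.

(** Countable sets have Lebesgue measure 0, while [0, 1] has measure 1. *)
Lemma realType_uncountable : ~ countable [set: R].
Proof.
move=> /countable_lebesgue_measure0 h.
have : (lebesgue_measure (`[0%R, 1%R]%classic : set R) <= lebesgue_measure [set: R])%E.
  by apply: le_measure => //; rewrite inE.
by rewrite h lebesgue_measure_itv /= lte_fin ltr01 sube0 lee_fin ler10.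
Qed.

Lemma subspace_uncountable M : vector_subspace nabs sp M ->
  (exists2 z, M z & z <> (fun _ => 0)) -> ~ countable M.
Proof.
move=> [_ [M0 lin]] [z Mz z0] /countable_injP [f fi]; apply: realType_uncountable.
have [i zi] := neq0_coord z0.
(* Real multiples of [z] are told apart at a nonzero coordinate; the summand 0 matches the closure
   property of a subspace. *)
apply/countable_injP; exists (fun r => f (fun i => emb r * z i + 0)) => r r' _ _.
move=> /fi; rewrite !inE => /(_ (lin _ _ _ Mz M0) (lin _ _ _ Mz M0)) E.
have := congr1 (fun g => g i) E => /=; rewrite !addr0 => /(mulIf zi).
exact: fmorph_inj.
Qed.

Lemma oscillation_LY_pair M x y (p q : nat -> nat) : vector_subspace nabs sp M ->
  (forall z, M z -> z <> (fun _ => 0) -> decays (fun k => NX (iter (p k) T z)) /\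
      forall A, exists m, forall k, (m <= k)%N -> A < NX (iter (q k) T z)) ->
  M x -> M y -> x <> y -> LY_scrambled_pair nabs sp T x y.
Proof.
move=> sM irr Mx My /subr_fun_neq0 xy; have [MX _] := sM.
have Mxy := subspaceB sM Mx My; have [small big] := irr _ Mxy xy.
have [inf0 supy] := irregular_of_sequences (MX _ Mxy) xy small big.
split; first exact: MX.
split; first exact: MX.
rewrite /orbit_dist; under eq_fun do rewrite iter_BwB.
by rewrite inf0 supy.
Qed.

Lemma weights_oscillateP : weights_oscillate <->
  (limn_einf (fun n : nat => (\prod_(0 <= j < n) nabs (w (- j%:Z)))%:E) = 0%E
   /\ ereal_sup (range (fun kn : int * nat =>
        (\prod_(0 <= i < kn.2.+1) nabs (w (kn.1 + i%:Z)))%:E)) = +oo%E).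
Proof.
split=> [[small big]|[inf0 supy]]; split.
- apply: limn_einf_eq0 => [n|e /small [n]].
    by rewrite (blk_back a) blk_gt0.
  by exists n; rewrite (blk_back a).
(* The maximum with 1 rules out the empty block, over which the supremum does not range. *)
- apply/eq_infty => A; have [k [n lt]] := big (Num.max A 1).
  have n0 : (0 < n)%N.
    case: n lt => // lt; move: lt; rewrite /blk big_nil gt_max ltxx andbF //.
  apply: le_trans (_ : (W k n)%:E <= _)%E.
    by rewrite lee_fin ltW // (le_lt_trans _ lt) // le_max lexx.
  (* [blk k] starts at position k+1, and the product in the statement has one factor more than its
     second index. *)
  apply: ereal_sup_ubound; exists (k + 1, n.-1) => //=.
  by rewrite prednK // (blk_forward a) addrK.
- move=> e e0; have [n] := limn_einf_small inf0 e0.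
  by rewrite (blk_back a); exists n.
move=> C; have /ereal_sup_gt [_ [[k n] _ <-]] : (C%:E < ereal_sup (range (fun kn : int * nat =>
        (\prod_(0 <= i < kn.2.+1) nabs (w (kn.1 + i%:Z)))%:E)))%E by rewrite supy ltry.
by rewrite lte_fin /= (blk_forward a); exists (k - 1), n.+1.
Qed.

Theorem weighted_shift_equivalences : weighted_shift_TFAE nabs sp w.
Proof.
have from2 : (exists x y, LY_scrambled_pair nabs sp T x y) -> weights_oscillate.
  by move=> [x [y /scrambled_semi_irregular]]; exact: semi_irregular_weights.
have from3 : LY_chaotic nabs sp T -> exists x y, LY_scrambled_pair nabs sp T x y.
  (* Without a scrambled pair the set would have at most one point. *)
  move=> [S [_ [uS pS]]]; apply: contrapT => no; apply: uS.
  have sing x y : S x -> S y -> x = y.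
    move=> Sx Sy; apply: contrapT => xy; apply: no; exists x, y; exact: pS.
  have [[x Sx]|S0] := pselect (exists x, S x).
    apply: sub_countable (countable1 x); apply: subset_card_le => y Sy; exact: sing.
  rewrite (_ : S = set0) //; apply/seteqP; split=> // x Sx; apply: S0; exists x; exact: Sx.
have from4 : (exists M, irregular_manifold nabs sp T M /\ dense_in_X nabs sp M) ->
    weights_oscillate.
  move=> [M [[[MX _] irrM] /nonzero_of_dense [z Mz z0]]].
  exact: semi_irregular_weights (irregular_semi_irregular (MX _ Mz) (irrM _ Mz z0)).
have from5 : densely_uniformly_LY_chaotic nabs sp T -> weights_oscillate.
  move=> [S [_ [_ [SX [[x [y [Sx [Sy xy]]]] [p [q /(_ _ _ Sx Sy xy) [small big]]]]]]]].
  have zX := inXB (SX _ Sx) (SX _ Sy).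
  apply: (@semi_irregular_weights (x \- y)); split=> //; first exact: subr_fun_neq0.
    move=> e e0; move/cvgr0Pnorm_lt/(_ _ e0): small => [m _ /(_ m (leqnn m))].
    by rewrite /= iter_BwB => /(le_lt_trans (ler_norm _)) lt; exists (p m).
  move=> /decays_bounded [C hC]; move/cvgryPgt/(_ C): big => [m _ /(_ m (leqnn m))].
  by rewrite /= iter_BwB ltNge hC.
(* Every implication of the cycle passes through [weights_oscillate]; the first four then read the
   next condition off the subspace given by [irregular_witnesses]. *)
split; last split; last split; last split.
- move=> /weights_oscillateP /irregular_witnesses [M [p [q [sM dM irr]]]].
  have [z Mz z0] := nonzero_of_dense dM.
  exists z, (fun _ => 0); apply: (oscillation_LY_pair sM irr) => //.
  exact: sM.2.1.
- move=> /from2 /irregular_witnesses [M [p [q [sM dM irr]]]]; exists M.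
  split; first exact: sM.1.
  split; first exact: subspace_uncountable (nonzero_of_dense dM).
  by move=> x y; exact: (oscillation_LY_pair sM irr).
- move=> /from3 /from2 /irregular_witnesses [M [p [q [sM dM irr]]]]; exists M.
  split=> //; split=> // z Mz z0; have [small big] := irr z Mz z0.
  exact: irregular_of_sequences (sM.1 _ Mz) z0 small big.
- move=> /from4 /irregular_witnesses [M [p [q [sM dM irr]]]]; exists M.
  split=> //; have [z Mz z0] := nonzero_of_dense dM.
  split; first by apply: subspace_uncountable; last exists z.
  split; first exact: sM.1.
  split; first by exists z, (fun _ => 0); split=> //; split => //; exact: sM.2.1.
  exists p, q => x y Mx My /subr_fun_neq0 xy.
  have [small big] := irr _ (subspaceB sM Mx My) xy.
  split; under eq_fun do rewrite iter_BwB.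
    apply/cvgr0Pnorm_le => e /small [m hm]; exists m => // k mk /=.
    by rewrite ger0_norm ?nrm_ge0 ?hm.
  by apply/cvgryPgt => A; have [m hm] := big A; exists m => // k mk /=; exact: hm.
by move=> /from5 /weights_oscillateP.
Qed.

End Orbits.
End WeightedShift.

(** * The modulus of complex scalars *)

Section ComplexModulus.
Variable R : realType.
Implicit Types z : complex.complex R.

(** The norm of a complex number is itself complex-valued; this identity carries its laws over to
    the real-valued [cmod]. *)
Lemma normr_cmod z : `|z| = (cmod z)%:C%C. Proof. by rewrite normc_def. Qed.

Lemma cmod_eq0 z : cmod z = 0 -> z = 0.
Proof. by move=> h; apply/normr0_eq0; rewrite normr_cmod h. Qed.

Lemma cmodM z z' : cmod (z * z') = cmod z * cmod z'.
Proof. by apply: (fmorph_inj (real_complex R)); rewrite rmorphM /= -!normr_cmod normrM. Qed.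

Lemma cmodD z z' : cmod (z + z') <= cmod z + cmod z'.
Proof. by rewrite -lecR rmorphD /= -!normr_cmod ler_normD. Qed.

Lemma cmod_real (r : R) : cmod (real_complex R r) = `|r|.
Proof. by rewrite /cmod /= expr0n addr0 sqrtr_sqr. Qed.

End ComplexModulus.

Local Close Scope classical_set_scope.

Theorem theorem3p10 (R : realType) (sp : seqspace R) :
  valid_space sp ->
  (forall w : int -> R, (exists M : R, forall j, `|w j| <= M) ->
     (forall j, w j != 0) -> weighted_shift_TFAE (fun a : R => `|a|) sp w) /\
  (forall w : int -> complex.complex R, (exists M : R, forall j, cmod (w j) <= M) ->
     (forall j, w j != 0) -> weighted_shift_TFAE (@cmod R) sp w).
Proof.
move=> vsp; split=> w [M hM] w0.
  (* The maximum with 1 turns the given bound on the weights into one that is at least 1. *)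
  apply: (@weighted_shift_equivalences R sp R _ idfun vsp _ _ _ _ w (Num.max 1 M)) => //.
  - exact: normr0_eq0.
  - exact: normrM.
  - exact: ler_normD.
  - by rewrite le_max lexx.
  - by move=> i; rewrite le_max hM orbT.
apply: (@weighted_shift_equivalences R sp _ _ (real_complex R) vsp _ _ _ _ w (Num.max 1 M)) => //.
- exact: cmod_eq0.
- exact: cmodM.
- exact: cmodD.
- exact: cmod_real.
- by rewrite le_max lexx.
- by move=> i; rewrite le_max hM orbT.
Qed.
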